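(* Let $k,n,p$ be positive integers, let $G\in\mathbb{R}^{k\times n}$, $H\in\mathbb{R}^{k\times p}$, $h\in\mathbb{R}^k$, and consider the polyhedral projection problem $$\text{(PP)}\qquad \text{compute } Y=\{y\in\mathbb{R}^p \mid \exists x\in\mathbb{R}^n:\ Gx+Hy\ge h\}$$ and the associated multiple objective linear program in the variables $(x,y)\in\mathbb{R}^n\times\mathbb{R}^p$ with $p+1$ objectives $$\text{(MOLP)}\qquad \min \begin{pmatrix} y\\ -e^Ty\end{pmatrix}\quad\text{s.t.}\quad Gx+Hy\ge h,$$ where $e=(1,\dots,1)^T\in\mathbb{R}^p$. If (PP) is feasible, i.e. there is $(x,y)\in\mathbb{R}^n\times\mathbb{R}^p$ with $Gx+Hy\ge h$, then a solution $(S^{\mathrm{poi}},S^{\mathrm{dir}})$ of (MOLP) exists. Every solution $(S^{\mathrm{poi}},S^{\mathrm{dir}})$ of (MOLP) is also a solution of (PP).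
   Context: Inequalities between vectors are componentwise. For $B\subseteq\mathbb{R}^d$ nonempty, $\operatorname{conv}B$ is the convex hull and $\operatorname{cone}B=\{\lambda x\mid \lambda\ge0,\ x\in\operatorname{conv}B\}$; $\operatorname{cone}\emptyset=\{0\}$. For $X\subseteq\mathbb{R}^{n+p}$, $\operatorname{proj}X\subseteq\mathbb{R}^p$ is the projection onto the last $p$ components. Solution of (PP): A point $(x,y)\in\mathbb{R}^n\times\mathbb{R}^p$ is feasible for (PP) if $Gx+Hy\ge h$; a direction $(x,y)\in\mathbb{R}^n\times(\mathbb{R}^p\setminus\{0\})$ is feasible for (PP) if $Gx+Hy\ge0$. A pair $(X^{\mathrm{poi}},X^{\mathrm{dir}})$ is feasible for (PP) if $X^{\mathrm{poi}}$ is a nonempty set of feasible points and $X^{\mathrm{dir}}$ is a set of feasible directions. It is a solution to (PP) if it is feasible, both sets are finite, and $Y=\operatorname{conv}\operatorname{proj}X^{\mathrm{poi}}+\operatorname{cone}\operatorname{proj}X^{\mathrm{dir}}$. Solution of (MOLP): Let $S=\{(x,y)\in\mathbb{R}^{n}\times\mathbb{R}^p\mid Gx+Hy\ge h\}$, $0^+S=\{(x,y)\in\mathbb{R}^{n}\times\mathbb{R}^p\mid Gx+Hy\ge0\}$, and let $P\in\mathbb{R}^{(p+1)\times(n+p)}$ be the matrix with $P(x,y)=(y,-e^Ty)$. For a set $X\subseteq\mathbb{R}^{n+p}$, write $P[X]=\{Pz\mid z\in X\}$. The ordering cone is $C=\mathbb{R}^{p+1}_+$ (nonnegative orthant). Feasible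 points are the elements of $S$; feasible directions are the elements of $0^+S\setminus\{0\}$. A point $z\in S$ is a minimizer if $Pz\notin P[S]+C\setminus\{0\}$. A direction $z\in0^+S\setminus\{0\}$ is a minimizer if $Pz\notin P[0^+S]+C\setminus\{0\}$. (Here $A+C\setminus\{0\}$ means $A+(C\setminus\{0\})$.) A pair $(S^{\mathrm{poi}},S^{\mathrm{dir}})$ is a solution of (MOLP) if $S^{\mathrm{poi}}$ is a nonempty finite set of feasible points, $S^{\mathrm{dir}}$ is a finite set of feasible directions, $\operatorname{conv}P[S^{\mathrm{poi}}]+\operatorname{cone}P[S^{\mathrm{dir}}]+C=P[S]+C$, and all elements of $S^{\mathrm{poi}}$ and of $S^{\mathrm{dir}}$ are minimizers.
   Formalization: A solution of (MOLP) may contain directions (x,0), which are not feasible directions of (PP); so it is shown to solve (PP) when no direction in S^dir has y = 0, and in general after the directions with y = 0 are removed from S^dir. *)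

(* Defs.v *)
From mathcomp Require Import all_boot all_order all_algebra.
From mathcomp Require Import boolp classical_sets cardinality reals convex.
Set Implicit Arguments.
Unset Strict Implicit.
Unset Printing Implicit Defensive.

Import Order.TTheory GRing.Theory Num.Theory.
Local Open Scope classical_set_scope.
Local Open Scope ring_scope.

Definition cvle (R : realType) (m : nat) (u v : 'cV[R]_m) : Prop :=
  forall i, u i 0 <= v i 0.

Definition minkowski_sum (V : zmodType) (A B : set V) : set V :=
  [set a + b | a in A & b in B].

Definition conv_hull (R : realType) (V : lmodType R) (B : set V) : set V :=
  smallest (@convex_set R V) B.

(* The summand [set 0] matters only for B = set0, giving cone set0 = [set 0]. *)
Definition cone (R : realType) (V : lmodType R) (B : set V) : set V :=
  [set 0] `|` [set l *: x | l in [set l : R | 0 <= l] & x in conv_hull B].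

Definition nonneg_orthant (R : realType) (m : nat) : set 'cV[R]_m :=
  [set w | cvle 0 w].

(* A pair (x, y) of R^n x R^p is the stacked column col_mx x y, so that
   x = usubmx z and y = dsubmx z. *)
Definition proj (R : realType) (n p : nat) (z : 'cV[R]_(n + p)) : 'cV[R]_p :=
  dsubmx z.

Section Problems.
Variables (R : realType) (k n p : nat).
Variables (G : 'M[R]_(k, n)) (H : 'M[R]_(k, p)) (h : 'cV[R]_k).
Implicit Types (z : 'cV[R]_(n + p)) (Xpoi Xdir : set 'cV[R]_(n + p)).

Definition feas : set 'cV[R]_(n + p) :=
  [set z | cvle h (G *m usubmx z + H *m dsubmx z)].

(* 0^+S is by definition the homogeneous system, also when feas is empty. *)
Definition feas_rec : set 'cV[R]_(n + p) :=
  [set z | cvle 0 (G *m usubmx z + H *m dsubmx z)].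

Definition pp_set : set 'cV[R]_p :=
  [set y | exists x : 'cV[R]_n, cvle h (G *m x + H *m y)].

(* Only z <> 0 is required in molp_feasible_dir: a direction (x, 0) with x <> 0
   and 0 <= G *m x is feasible (and a minimizer) there but not here. *)
Definition pp_feasible_dir z : Prop := feas_rec z /\ proj z <> 0.

Definition pp_feasible_pair Xpoi Xdir : Prop :=
  [/\ Xpoi !=set0, Xpoi `<=` feas & forall z, Xdir z -> pp_feasible_dir z].

Definition pp_solution Xpoi Xdir : Prop :=
  [/\ pp_feasible_pair Xpoi Xdir, finite_set Xpoi, finite_set Xdir &
      pp_set = minkowski_sum (conv_hull (@proj R n p @` Xpoi))
                             (cone (@proj R n p @` Xdir))].

Definition objective_mx : 'M[R]_(p + 1, n + p) :=
  block_mx 0 1%:M 0 (- const_mx 1).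

Definition objective z : 'cV[R]_(p + 1) := objective_mx *m z.

Lemma objectiveE (x : 'cV[R]_n) (y : 'cV[R]_p) :
  objective (col_mx x y) = col_mx y (- ((const_mx 1 : 'cV[R]_p)^T *m y)).
Proof.
by rewrite /objective mul_block_col !mul0mx !add0r mul1mx mulNmx trmx_const.
Qed.

Definition ordering_cone : set 'cV[R]_(p + 1) := @nonneg_orthant R (p + 1).

Definition molp_feasible_dir z : Prop := feas_rec z /\ z <> 0.

Definition point_minimizer z : Prop :=
  feas z /\
  ~ minkowski_sum (objective @` feas) (ordering_cone `\ 0) (objective z).

Definition dir_minimizer z : Prop :=
  molp_feasible_dir z /\
  ~ minkowski_sum (objective @` feas_rec) (ordering_cone `\ 0) (objective z).

Definition molp_solution Spoi Sdir : Prop :=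
  [/\ [/\ Spoi !=set0, finite_set Spoi & Spoi `<=` feas],
      finite_set Sdir /\ (forall z, Sdir z -> molp_feasible_dir z),
      minkowski_sum
        (minkowski_sum (conv_hull (objective @` Spoi))
                       (cone (objective @` Sdir)))
        ordering_cone
      = minkowski_sum (objective @` feas) ordering_cone,
      forall z, Spoi z -> point_minimizer z &
      forall z, Sdir z -> dir_minimizer z].

End Problems.

(* Main.v *)
From HB Require Import structures.
Require Import Defs.
From mathcomp Require Import all_boot all_order all_algebra.
From mathcomp Require Import boolp classical_sets cardinality reals convex.
From mathcomp Require Import interval_inference.
Local Open Scope classical_set_scope.
Local Open Scope ring_scope.

Import Order.TTheory GRing.Theory Num.Theory.

(** The last objective [- e^T y] is chosen so that the entries of [objective z]
    always sum to zero, while every nonzero vector of the ordering cone has a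
    positive entry sum. Two images that differ by an element of the ordering
    cone are therefore equal ([objective_antichain]), and both halves of the
    theorem follow from this.

    Existence: nothing dominates an image, so every feasible point and every
    nonzero feasible direction is a minimizer, and a solution is the same thing
    as a finite description of the feasible polyhedron as
    [conv_hull P + cone D]. Such a description is the Minkowski-Weyl theorem
    ([minkowski_weyl]), proved here by the double description method: a
    finitely generated cone cut by a half-space is again finitely generated
    ([cone_halfspace]); starting from the whole space and cutting once for each
    inequality gives finitely many generators of every polyhedral cone; and a
    polyhedron is the slice at height one of such a cone in one dimension more.

    Every solution of the vector program solves the projection problem: for a
    feasible [z], the defining identity of a solution writes [objective z] as
    [objective (x + d) + c] with [x] in the hull of the points, [d] in the cone
    of the directions and [c] in the ordering cone. Then [c] is zero, and
    reading off the first [p] entries gives [proj z = proj x + proj d]. The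
    reverse inclusion holds since [x + d] is feasible. Directions projecting to
    zero add nothing to a cone ([cone_setD0]), so they may be discarded. *)

(** * Convex hulls and convex cones *)

Lemma convex_setE {R : realType} {V : lmodType R} (A : set V) :
  @convex_set R V A <->
  forall x y t, 0 <= t -> t <= 1 -> A x -> A y -> A (t *: x + (1 - t) *: y).
Proof.
split=> [cA x y t t0 t1 Ax Ay|cA x y l].
  have := cA x y (Itv01 t0 t1); rewrite !inE; exact.
by rewrite !inE => Ax Ay; apply: cA.
Qed.

(** [cone B] is the least such set containing [B] ([cone_convex_cone],
    [sub_cone], [cone_min]), so a property of its elements is proved, without
    writing them as sums of generators, by checking that it defines a convex
    cone and holds on [B]. *)
Definition convex_cone {R : realType} {V : lmodType R} (K : set V) : Prop :=
  [/\ K 0, forall u v, K u -> K v -> K (u + v)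
    & forall l u, 0 <= l -> K u -> K (l *: u)].

Lemma convex_cone_convex {R : realType} {V : lmodType R} (K : set V) :
  convex_cone K -> @convex_set R V K.
Proof.
case=> _ KD KZ; apply/convex_setE => x y t t0 t1 Kx Ky.
by apply: (KD); apply: (KZ) => //; rewrite subr_ge0.
Qed.

Lemma conv_hull_convex {R : realType} {V : lmodType R} (B : set V) :
  @convex_set R V (conv_hull B).
Proof.
apply/convex_setE => x y t t0 t1 Bx By A [cA sA].
by move: (cA) => /convex_setE; apply=> //; [exact: Bx|exact: By].
Qed.

Lemma sub_conv_hull {R : realType} {V : lmodType R} (B : set V) :
  B `<=` conv_hull B.
Proof. exact: sub_gen_smallest. Qed.

Lemma conv_hull_min {R : realType} {V : lmodType R} (B A : set V) :
  @convex_set R V A -> B `<=` A -> conv_hull B `<=` A.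
Proof. exact: smallest_sub. Qed.

(** Two positive multiples [a *: x] and [b *: y] of points of the hull add up
    to a multiple, by [a + b], of a convex combination of [x] and [y]. *)
Lemma cone_convex_cone {R : realType} {V : lmodType R} (B : set V) :
  convex_cone (cone B).
Proof.
split; first by left.
- move=> u v [->|[a /= a0 [x Bx <-]]]; first by rewrite add0r.
  move=> [->|[b /= b0 [y By <-]]].
    by rewrite addr0; right; exists a => //; exists x.
  have [ab0|ab0] := eqVneq (a + b) 0.
    have : (a == 0) && (b == 0) by rewrite -paddr_eq0 ?ab0.
    by move=> /andP[/eqP -> /eqP ->]; left; rewrite !scale0r addr0.
  right; exists (a + b); first by rewrite /= addr_ge0.
  exists (a / (a + b) *: x + (1 - a / (a + b)) *: y).
    have /convex_setE := conv_hull_convex B; apply=> //.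
      by rewrite divr_ge0 ?addr_ge0.
    by rewrite ler_pdivrMr ?mul1r ?lerDl// lt0r ab0 addr_ge0.
  rewrite scalerDr !scalerA mulrBr mulr1 mulrCA divff// mulr1.
  by rewrite [a + b]addrC addrK.
- move=> l u l0 [->|[a /= a0 [x Bx <-]]]; first by left; rewrite scaler0.
  by right; exists (l * a); [exact: mulr_ge0|exists x; rewrite ?scalerA].
Qed.

Lemma sub_cone {R : realType} {V : lmodType R} (B : set V) : B `<=` cone B.
Proof.
move=> x Bx; right; exists 1; first exact: ler01.
by exists x; [exact: sub_conv_hull|rewrite scale1r].
Qed.

Lemma cone_min {R : realType} {V : lmodType R} (B K : set V) :
  convex_cone K -> B `<=` K -> cone B `<=` K.
Proof.
move=> cK BK x [->|[l /= l0 [y By <-]]]; first by case: cK.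
have [_ _] := cK; apply=> //.
by apply: conv_hull_min By => //; exact: convex_cone_convex.
Qed.

Lemma minkowski_sum_convex_cone {R : realType} {V : lmodType R} (A B : set V) :
  convex_cone A -> convex_cone B -> convex_cone (minkowski_sum A B).
Proof.
move=> [A0 AD AZ] [B0 BD BZ]; split.
- by exists 0 => //; exists 0; rewrite ?addr0.
- move=> _ _ [a Aa [b Bb <-]] [a' Aa' [b' Bb' <-]].
  exists (a + a'); first exact: AD.
  by exists (b + b'); [exact: BD|rewrite addrACA].
- move=> l _ l0 [a Aa [b Bb <-]]; exists (l *: a); first exact: AZ.
  by exists (l *: b); [exact: BZ|rewrite scalerDr].
Qed.

Lemma cone_setD0 {R : realType} {V : lmodType R} (B : set V) :
  cone (B `\ 0) = cone B.
Proof.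
apply/seteqP; split; apply: cone_min; try exact: cone_convex_cone.
  by move=> x [Bx _]; exact: sub_cone.
move=> x Bx; have [->|/eqP x0] := eqVneq x 0; first by left.
exact: sub_cone.
Qed.

Lemma linear_conv_hull {R : realType} {V W : lmodType R} (g : {linear V -> W})
    (B : set V) : conv_hull (g @` B) = g @` conv_hull B.
Proof.
apply/seteqP; split.
  apply: conv_hull_min; last by apply: image_subset; exact: sub_conv_hull.
  apply/convex_setE => _ _ t t0 t1 [x Bx <-] [y By <-].
  exists (t *: x + (1 - t) *: y); last by rewrite linearD !linearZ.
  by have /convex_setE := conv_hull_convex B; apply.
move=> _ [x Bx <-]; apply: (conv_hull_min B (g @^-1` conv_hull (g @` B))) Bx.
  apply/convex_setE => u v t t0 t1 /= Bu Bv; rewrite linearD !linearZ.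
  by have /convex_setE := conv_hull_convex (g @` B); apply.
by move=> u Bu /=; apply: sub_conv_hull; exists u.
Qed.

Lemma linear_cone {R : realType} {V W : lmodType R} (g : {linear V -> W})
    (B : set V) : cone (g @` B) = g @` cone B.
Proof.
rewrite /cone linear_conv_hull; apply/seteqP; split=> w.
  move=> [->|[l l0 [_ [x Bx <-] <-]]]; first by exists 0; rewrite ?linear0//; left.
  by exists (l *: x); [right; exists l => //; exists x|rewrite linearZ].
move=> [_ [->|[l l0 [x Bx <-]]] <-]; first by left; exact: linear0.
by right; exists l => //; exists (g x); [exists x|rewrite linearZ].
Qed.

Lemma linear_minkowski_sum {R : realType} {V W : lmodType R}
    (g : {linear V -> W}) (A B : set V) :
  g @` minkowski_sum A B = minkowski_sum (g @` A) (g @` B).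
Proof.
apply/seteqP; split=> w.
  move=> [_ [a Aa [b Bb <-]] <-]; exists (g a); first by exists a.
  by exists (g b); [exists b|rewrite linearD].
move=> [_ [a Aa <-] [_ [b Bb <-] <-]]; exists (a + b); last exact: linearD.
by exists a => //; exists b.
Qed.

(** * The Minkowski-Weyl theorem *)

(** Keep the generators [w] with [0 <= f w] and replace those [v] with [f v < 0]
    by the points [mix w v] where the segments from such [w] to such [v], up to
    scaling, cross the hyperplane [f = 0]. These clearly lie in the cut cone.
    Conversely write a point of the cut cone as [a + b], with [a] generated by
    the kept generators and [b] by the discarded ones. Adding parts of [b] only
    decreases [f], so all partial sums stay in the half-space, and each single
    step [z + v] is a nonnegative combination of [z] and [mix z v]. *)
Lemma cone_halfspace {R : realType} {V : lmodType R} (f : {scalar V})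
    (B : set V) : finite_set B ->
  exists2 B', finite_set B' & cone B `&` [set z | 0 <= f z] = cone B'.
Proof.
move=> finB.
pose pos := B `&` [set z | 0 <= f z]; pose neg := B `&` [set z | f z < 0].
pose mix (w v : V) := f w *: v - f v *: w.
exists (pos `|` [set mix w v | w in pos & v in neg]).
  rewrite finite_setU; split; first exact: finite_setIl.
  by apply: finite_image2; apply: finite_setIl.
set B' := _ `|` _.
have f_mix w v : f (mix w v) = 0.
  by rewrite linearB !linearZ /= mulrC subrr.
have [K0 KD KZ] := cone_convex_cone B.
have [K'0 K'D K'Z] := cone_convex_cone B'.
apply/seteqP; split; last first.
  apply: cone_min.
    split; first by split=> //=; rewrite linear0.
    - move=> u v [Ku fu] [Kv fv]; split; first exact: KD.
      by rewrite /= linearD addr_ge0.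
    - move=> l u l0 [Ku fu]; split; first exact: KZ.
      by rewrite /= linearZ mulr_ge0.
  move=> z [[Bz fz]|[w [Bw fw] [v [Bv fv] <-]]].
    by split=> //; exact: sub_cone.
  split; last by rewrite /= f_mix.
  rewrite /mix -scaleNr; apply: (KD); apply: (KZ) => //; try exact: sub_cone.
  by rewrite oppr_ge0 ltW.
(* [mix z v] is linear in [z], so it is enough to look at the generators [z]:
   for those in [pos] it is a new generator, and for [z = mix w v'] it is a
   multiple of [z] because [f z = 0]. *)
have mixK' v : neg v -> cone B' `<=` [set z | 0 <= f z /\ cone B' (mix z v)].
  move=> [Bv fv]; have Nfv : 0 <= - f v by rewrite oppr_ge0 ltW.
  apply: cone_min.
    split; rewrite /mix.
    - by split; rewrite linear0// scale0r scaler0 subrr.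
    - move=> u u' [fu Ku] [fu' Ku']; split; first by rewrite linearD /= addr_ge0.
      by rewrite linearD scalerDl scalerDr opprD addrACA; exact: K'D.
    - move=> l u l0 [fu Ku]; split; first by rewrite linearZ /= mulr_ge0.
      by have := K'Z _ _ l0 Ku; rewrite /mix scalerBr !scalerA [l * f v]mulrC [f (l *: u)]linearZ.
  move=> z [[Bz fz]|[w [Bw fw] [v' [Bv' fv'] <-]]]; split=> //.
  - by apply: sub_cone; right; exists z => //; exists v.
  - by rewrite f_mix.
  - rewrite /mix -/(mix w v') f_mix scale0r add0r -scaleNr; apply: (K'Z) => //.
    by apply: sub_cone; right; exists w => //; exists v'.
(* The summands of an element of [cone neg] can be added one at a time; the
   bound [f q <= 0] is what makes the invariant stable under addition. *)
have absorb : cone neg `<=` [set q | f q <= 0 /\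
    forall z, cone B' z -> 0 <= f (z + q) -> cone B' (z + q)].
  apply: cone_min.
    split; first by split=> [|z]; rewrite ?linear0 ?addr0.
    - move=> q q' [fq Kq] [fq' Kq']; split.
        by rewrite linearD -oppr_ge0 opprD addr_ge0 ?oppr_ge0.
      move=> z Kz; rewrite addrA => fz; apply: (Kq') => //; apply: Kq => //.
      by apply: le_trans fz _; rewrite [f (z + q + q')]linearD gerDl.
    - move=> l q; rewrite le0r => /orP[/eqP -> _|l0 [fq Kq]].
        by rewrite scale0r; split=> [|z]; rewrite ?linear0 ?addr0.
      split; first by rewrite linearZ /= pmulr_rle0.
      have lE z : z + l *: q = l *: (l^-1 *: z + q).
        by rewrite scalerDr scalerA divff ?scale1r// gt_eqF.
      move=> z Kz; rewrite lE linearZ /= pmulr_rge0// => fz.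
      apply: (K'Z); first exact: ltW.
      by apply: Kq fz; apply: (K'Z) => //; rewrite invr_ge0 ltW.
  move=> v nv; have [Bv fv] := nv; split; first exact: ltW.
  move=> z Kz; rewrite linearD /= => fz.
  have fz0 : 0 < f z by rewrite -(subrr (f v)) ltrBlDr; rewrite (lt_le_trans fv)//.
  (* cancelling the [v]-component against [z] leaves a nonnegative multiple
     of [z] *)
  have -> : z + v = ((f z + f v) / f z) *: z + (f z)^-1 *: mix z v.
    rewrite /mix scalerBr !scalerA mulVf ?gt_eqF// scale1r addrCA -scalerBl.
    by rewrite mulrDl divff ?gt_eqF// [(f z)^-1 * _]mulrC addrK scale1r addrC.
  apply: (K'D); apply: (K'Z); rewrite ?divr_ge0 ?invr_ge0 ?(ltW fz0)//.
  by case: (mixK' _ nv _ Kz).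
move=> z [Kz fz].
have /(_ z Kz) [a Ka [b Kb ab]] : cone B `<=` minkowski_sum (cone pos) (cone neg).
  apply: cone_min.
    by apply: minkowski_sum_convex_cone; exact: cone_convex_cone.
  move=> x Bx; have [fx|fx] := leP 0 (f x).
    by exists x; [exact: sub_cone|exists 0; [left|rewrite addr0]].
  by exists 0; [left|exists x; [exact: sub_cone|rewrite add0r]].
rewrite -ab; have [_] := absorb b Kb; apply; last by rewrite ab.
apply: cone_min Ka => // x px; by apply: sub_cone; left.
Qed.

(** A basis together with its opposite generates: the sign of each coordinate
    decides which of the two vectors is taken. *)
Lemma cone_fullspace {R : realType} (V : vectType R) :
  exists2 B : set V, finite_set B & cone B = setT.
Proof.
pose X := vbasis {: V}.
exists ([set` X] `|` -%R @` [set` X]).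
  by rewrite finite_setU; split; [|apply: finite_image]; exact: finite_seq.
apply/seteqP; split=> // z _; rewrite (coord_vbasis (memvf z)).
have [K0 KD KZ] := cone_convex_cone ([set` X] `|` -%R @` [set` X]).
apply: (big_ind (cone _)) => // i _.
have Xi : X`_i \in X by rewrite mem_nth// size_tuple.
have [c0|c0] := leP 0 (coord X i z).
  by apply: (KZ) => //; apply: sub_cone; left.
rewrite -[X in cone _ X]opprK -scalerN -scaleNr.
by apply: (KZ); [rewrite oppr_ge0 ltW|apply: sub_cone; right; exists X`_i].
Qed.

Lemma polyhedral_cone_finite {R : realType} (V : vectType R) (k : nat)
    (f : 'I_k -> {scalar V}) :
  exists2 B, finite_set B & [set z | forall i, 0 <= f i z] = cone B.
Proof.
elim: k f => [|k IH] f.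
  have [B finB BT] := cone_fullspace V; exists B => //.
  by rewrite BT; apply/seteqP; split=> // z _ [].
have [B finB BE] := IH (fun i => f (lift ord0 i)).
have [B' finB' B'E] := cone_halfspace (f ord0) B finB.
exists B' => //; rewrite -B'E -BE; apply/seteqP; split=> z /=.
  by move=> fz; split.
by move=> [fz fz0] i; case: (unliftP ord0 i) => [j ->|->].
Qed.

(** Homogenization: the pairs [(z, t)] with [0 <= t] and [b i * t <= f i z] form
    a polyhedral cone, hence [cone B] with [B] finite, and the polyhedron is
    its slice [t = 1]. The generators with [t > 0], rescaled to [t = 1], give
    the points [P]; those with [t = 0] give the directions [D]. *)
Lemma minkowski_weyl {R : realType} (V : vectType R) (k : nat)
    (f : 'I_k -> {scalar V}) (b : 'I_k -> R) :
  exists P D : set V,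
    [/\ finite_set P, finite_set D, D `<=` [set d | forall i, 0 <= f i d] &
        [set z | forall i, b i <= f i z] = minkowski_sum (conv_hull P) (cone D)].
Proof.
pose W : vectType R := (V * R^o)%type.
pose g0 i (u : W) : R := f i u.1 - b i * u.2.
have g_lin i : scalar (g0 i).
  move=> l u v; rewrite /g0 /= linearP /= mulrDr mulrBr opprD addrACA.
  by congr (_ - _ + _); rewrite mulrCA.
pose g i : {scalar W} := HB.pack (g0 i) (GRing.isLinear.Build _ _ _ _ (g0 i) (g_lin i)).
pose t0 (u : W) : R := u.2.
have t_lin : scalar t0 by [].
pose t : {scalar W} := HB.pack t0 (GRing.isLinear.Build _ _ _ _ t0 t_lin).
have [B1 finB1 B1E] := polyhedral_cone_finite W k g.
have [B finB BE] := cone_halfspace t B1 finB1.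
have {BE}KE u : cone B u <-> (forall i, b i * u.2 <= f i u.1) /\ 0 <= u.2.
  rewrite -BE -B1E /=; split=> -[gu tu]; split=> // i.
    by rewrite -subr_ge0; exact: gu.
  by have : 0 <= f i u.1 - b i * u.2 by rewrite subr_ge0.
have [K0 KD KZ] := cone_convex_cone B.
pose P := (fun u : W => u.2^-1 *: u.1) @` (B `&` [set u | 0 < u.2]).
pose D := @fst V R^o @` (B `&` [set u | u.2 = 0]).
have PK x : conv_hull P x -> cone B (x, 1).
  apply: (conv_hull_min P [set x | cone B (x, 1)]).
    apply/convex_setE => x' y s s0 s1 /= Kx Ky.
    have -> : (s *: x' + (1 - s) *: y, 1 : R^o) = s *: ((x', 1) : W) + (1 - s) *: ((y, 1) : W).
      by congr pair; rewrite /= /GRing.scale /= !mulr1 addrC subrK.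
    by apply: (KD); apply: (KZ); rewrite ?subr_ge0.
  move=> _ [u [Bu /= u0] <-].
  have -> : (u.2^-1 *: u.1, 1 : R^o) = u.2^-1 *: u.
    by congr pair; rewrite /= /GRing.scale /= mulVf ?gt_eqF.
  by apply: (KZ); [rewrite invr_ge0 ltW|exact: sub_cone].
have DK d : cone D d -> cone B (d, 0).
  apply: (cone_min D [set d | cone B (d, 0)]).
    split=> //.
    - move=> u v /= Ku Kv.
      have -> : (u + v, 0 : R^o) = ((u, 0) : W) + ((v, 0) : W).
        by congr pair; rewrite /= addr0.
      exact: KD.
    - move=> l u l0 /= Ku.
      have -> : (l *: u, 0 : R^o) = l *: ((u, 0) : W).
        by congr pair; rewrite /= scaler0.
      exact: KZ.
  by move=> _ [[x s] [Bu /= s0] <-]; rewrite -{1}s0; exact: sub_cone.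
exists P, D; split.
- by apply: finite_image; exact: finite_setIl.
- by apply: finite_image; exact: finite_setIl.
- move=> d Dd i; have /KE[/(_ i)] := DK d (sub_cone _ _ Dd).
  by rewrite /= mulr0.
apply/seteqP; split=> [z fz|_ [x Px [d Dd <-]] i].
- pose lift1 : set W := [set (x, 1) | x in P].
  pose lift0 : set W := [set (d, 0) | d in D].
  (* In a decomposition of [(z, 1)] the second summand has height zero, so the
     first has height one and is a convex combination of [P] unscaled. *)
  have sub : cone B `<=` minkowski_sum (cone lift1) (cone lift0).
    apply: cone_min.
      by apply: minkowski_sum_convex_cone; exact: cone_convex_cone.
    move=> u Bu; have /KE[_] := sub_cone _ _ Bu.
    rewrite le0r => /orP[/eqP u0|u0].
      exists 0; first by left.
      exists (u.1, 0); last by rewrite add0r -u0; case: (u).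
      by apply: sub_cone; exists u.1 => //; exists u.
    exists u; last by exists 0; [left|rewrite addr0].
    have [_ _ CZ] := cone_convex_cone lift1.
    have -> : u = u.2 *: ((u.2^-1 *: u.1, 1) : W).
      case: u u0 {Bu} => x s /= s0; congr pair; rewrite /= ?scalerA ?divff ?gt_eqF//.
        by rewrite scale1r.
      by rewrite /GRing.scale /= mulr1.
    apply: CZ; first exact: ltW.
    by apply: sub_cone; exists (u.2^-1 *: u.1) => //; exists u.
  have /sub[a Ka [c Kc ac]] : cone B (z, 1).
    by apply/KE => /=; split=> // i; rewrite mulr1.
  have [c2 Dc] : c.2 = 0 /\ cone D c.1.
    have [C0 CD CZ] := cone_convex_cone D.
    apply: (cone_min lift0 [set c | c.2 = 0 /\ cone D c.1]) Kc.
      split=> //.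
      - move=> u v [u2 Du] [v2 Dv]; split; first by rewrite /= u2 v2 addr0.
        exact: CD.
      - move=> l u l0 [u2 Du]; split; first by rewrite /= u2 scaler0.
        exact: CZ.
    by move=> _ [d Dd <-]; split=> //; exact: sub_cone.
  have a2 : a.2 = 1.
    by have := congr1 snd ac; rewrite /= c2 addr0.
  case: Ka a2 ac => [->/= /eqP|]; first by rewrite eq_sym oner_eq0.
  move=> [l l0 [x Px <-]].
  have [x2 {}Px] : x.2 = 1 /\ conv_hull P x.1.
    apply: (conv_hull_min lift1 [set x | x.2 = 1 /\ conv_hull P x.1]) Px.
      apply/convex_setE => u v s s0 s1 /= [u2 Pu] [v2 Pv]; split.
        by rewrite u2 v2 /GRing.scale /= !mulr1 addrC subrK.
      by have /convex_setE := conv_hull_convex P; apply.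
    by move=> _ [q Pq <-]; split=> //; exact: sub_conv_hull.
  rewrite /= x2 /GRing.scale /= mulr1 => l1; rewrite l1 => ac.
  exists x.1 => //; exists c.1 => //.
  by have := congr1 fst ac; rewrite /= scale1r.
- have /KE[/= /(_ i)] := KD _ _ (PK x Px) (DK d Dd).
  by rewrite /= addr0 mulr1.
Qed.

(** * The associated multiple objective linear program *)

Section MOLP.
Context {R : realType} {k n p : nat}.
Variables (G : 'M[R]_(k, n)) (H : 'M[R]_(k, p)) (h : 'cV[R]_k).
Implicit Type z : 'cV[R]_(n + p).

Definition constraint i z : R := (G *m usubmx z + H *m dsubmx z) i 0.

Lemma constraint_is_scalar i : scalar (constraint i).
Proof.
move=> l u v; rewrite /constraint !linearP /= addrACA -!scalerDr.
by rewrite mxE [X in X + _]mxE.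
Qed.

HB.instance Definition _ i := GRing.isLinear.Build R 'cV[R]_(n + p) R *%R
  (constraint i) (constraint_is_scalar i).

Lemma feas_recE z : feas_rec G H z <-> forall i, 0 <= constraint i z.
Proof.
by split=> Rz i; have := Rz i; rewrite /constraint [(0 : 'cV[R]_k) i 0]mxE.
Qed.

Lemma feas_finitely_generated :
  exists P D : set 'cV[R]_(n + p),
    [/\ finite_set P, finite_set D, D `<=` feas_rec G H &
        feas G H h = minkowski_sum (conv_hull P) (cone D)].
Proof.
have [P [D [finP finD DR SE]]] := minkowski_weyl _ k constraint (fun i => h i 0).
by exists P, D; split=> // d Dd; apply/feas_recE; exact: DR.
Qed.

Lemma feas_convex : @convex_set R _ (feas G H h).
Proof.
apply/convex_setE => x y t t0 t1 Sx Sy i.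
rewrite -/(constraint i _) linearD !linearZ /=.
rewrite -[h i 0]mul1r -[X in X * _](subrK t) addrC mulrDl.
by apply: lerD; apply: ler_wpM2l; rewrite ?subr_ge0//.
Qed.

Lemma feas_rec_convex_cone : convex_cone (feas_rec G H).
Proof.
split.
- by apply/feas_recE => i; rewrite linear0.
- move=> u v /feas_recE Ru /feas_recE Rv; apply/feas_recE => i.
  by rewrite linearD /= addr_ge0.
- move=> l u l0 /feas_recE Ru; apply/feas_recE => i.
  by rewrite linearZ /= mulr_ge0.
Qed.

Lemma feasD z d : feas G H h z -> feas_rec G H d -> feas G H h (z + d).
Proof.
move=> Sz /feas_recE Rd i; rewrite -/(constraint i _) linearD /=.
by rewrite -[h i 0]addr0 lerD//; exact: Sz.
Qed.

Lemma pp_setE : pp_set G H h = @proj R n p @` feas G H h.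
Proof.
apply/seteqP; split=> [y [x Sxy]|_ [z Sz <-]].
  by exists (col_mx x y); rewrite /proj /feas /= ?col_mxKd ?col_mxKu.
by exists (usubmx z).
Qed.

Lemma usubmx_objective z : usubmx (objective z) = proj z.
Proof. by rewrite -[z]vsubmxK objectiveE col_mxKu /proj col_mxKd. Qed.

Lemma objective_sum0 z : \sum_i objective z i 0 = 0.
Proof.
rewrite -[z]vsubmxK objectiveE big_split_ord /= big_ord1 col_mxEd.
under eq_bigr do rewrite col_mxEu.
rewrite !mxE; apply/eqP; rewrite subr_eq0; apply/eqP.
by apply: eq_bigr => i _; rewrite !mxE mul1r.
Qed.

Lemma ordering_cone_sum0 (w : 'cV[R]_(p + 1)) :
  ordering_cone w -> \sum_i w i 0 = 0 -> w = 0.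
Proof.
move=> w0 sw; apply/matrixP => i j; rewrite ord1 [RHS]mxE.
have w_ge0 l : true -> 0 <= w l 0 by move=> _; have := w0 l; rewrite mxE.
by apply: (psumr_eq0P w_ge0 sw).
Qed.

(** Both images have entry sum zero, hence so has their nonnegative difference
    [c]. *)
Lemma objective_antichain (x y : 'cV[R]_(n + p)) c :
  ordering_cone c -> objective x + c = objective y -> c = 0.
Proof.
move=> Cc xc; apply: ordering_cone_sum0 => //.
have := objective_sum0 y; rewrite -xc; under eq_bigr do rewrite mxE.
by rewrite big_split /= objective_sum0 add0r.
Qed.

Lemma objective_nondominated (A : set 'cV[R]_(n + p)) z :
  ~ minkowski_sum (@objective R n p @` A) (@ordering_cone R p `\ 0) (objective z).
Proof.
by move=> [_ [x _ <-] [c [Cc c0] xc]]; exact: c0 (objective_antichain x z c Cc xc).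
Qed.

(** The zero vector is not a feasible direction of the vector program, hence
    its removal from [D]; the cone does not change. *)
Lemma molp_solution_exists : feas G H h !=set0 ->
  exists Spoi Sdir, molp_solution G H h Spoi Sdir.
Proof.
have [P [D [finP finD DR SE]]] := feas_finitely_generated; move=> [z Sz].
have PS : P `<=` feas G H h.
  move=> x Px; rewrite SE; exists x; first exact: sub_conv_hull.
  by exists 0; [left|rewrite addr0].
exists P, (D `\ 0); split; first split=> //.
- apply/set0P/eqP => P0; move: Sz; rewrite SE => -[x + _].
  by rewrite P0; apply: (conv_hull_min set0 set0) => //; apply/convex_setE.
- split; first exact: sub_finite_set finD.
  by move=> d [Dd d0]; split=> //; exact: DR.
- rewrite (linear_conv_hull (mulmx (objective_mx R n p))).
  rewrite (linear_cone (mulmx (objective_mx R n p))).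
  by rewrite -(linear_minkowski_sum (mulmx (objective_mx R n p))) cone_setD0 -SE.
- by move=> x Px; split; [exact: PS|exact: objective_nondominated].
- move=> d [Dd d0]; split; last exact: objective_nondominated.
  by split=> //; exact: DR.
Qed.

Lemma molp_solution_pp_set Spoi Sdir : molp_solution G H h Spoi Sdir ->
  pp_set G H h = minkowski_sum (conv_hull (@proj R n p @` Spoi))
                               (cone (@proj R n p @` Sdir)).
Proof.
move=> [[_ _ PS] [_ DS] SE _ _].
rewrite (linear_conv_hull dsubmx) (linear_cone dsubmx) pp_setE.
apply/seteqP; split=> [_ [z Sz <-]|_ [_ [x Px <-] [_ [d Dd <-] <-]]].
- have : minkowski_sum (@objective R n p @` feas G H h) (@ordering_cone R p)
           (objective z).
    exists (objective z); first by exists z.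
    by exists 0; rewrite ?addr0// => i; exact: lexx.
  rewrite -SE (linear_conv_hull (mulmx (objective_mx R n p))).
  rewrite (linear_cone (mulmx (objective_mx R n p))).
  move=> [_ [_ [x Px <-] [_ [d Dd <-] <-]] [c Cc E]].
  have E' : objective (x + d) + c = objective z by rewrite -E -linearD.
  have c0 := objective_antichain (x + d) z c Cc E'.
  exists (dsubmx x); first by exists x.
  exists (dsubmx d); first by exists d.
  by rewrite -linearD -[RHS]usubmx_objective -E' c0 addr0 usubmx_objective.
- exists (x + d); last exact: linearD.
  apply: feasD; first by apply: conv_hull_min Px => //; exact: feas_convex.
  apply: cone_min Dd; first exact: feas_rec_convex_cone.
  by move=> u /DS[].
Qed.

Lemma molp_solution_pp_solution Spoi Sdir : molp_solution G H h Spoi Sdir ->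
  pp_solution G H h Spoi [set z | Sdir z /\ proj z <> 0].
Proof.
move=> sol; have YE := molp_solution_pp_set _ _ sol.
have [[P0 finP PS] [finD DS] _ _ _] := sol; split=> //.
- by split=> // z [/DS[Rz _] pz].
- by apply: sub_finite_set finD => z [].
- rewrite YE -(cone_setD0 (_ @` Sdir)); congr (minkowski_sum _ (cone _)).
  apply/seteqP; split=> [_ [[z Dz <-] z0]|_ [z [Dz z0] <-]].
    by exists z.
  by split; [exists z|].
Qed.

End MOLP.

Theorem theorem3 (R : realType) (k n p : nat)
    (hk : (0 < k)%N) (hn : (0 < n)%N) (hp : (0 < p)%N)
    (G : 'M[R]_(k, n)) (H : 'M[R]_(k, p)) (h : 'cV[R]_k) :
  ((exists (x : 'cV[R]_n) (y : 'cV[R]_p), cvle h (G *m x + H *m y)) ->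
   exists Spoi Sdir : set 'cV[R]_(n + p), molp_solution G H h Spoi Sdir)
  /\
  (forall Spoi Sdir : set 'cV[R]_(n + p),
     molp_solution G H h Spoi Sdir ->
     ((forall z, Sdir z -> proj z <> 0) -> pp_solution G H h Spoi Sdir)
     /\
     pp_solution G H h Spoi [set z | Sdir z /\ proj z <> 0]).
Proof.
split=> [[x [y xy]]|Spoi Sdir sol].
  apply: molp_solution_exists; exists (col_mx x y).
  by rewrite /feas /= col_mxKu col_mxKd.
have ppsol := molp_solution_pp_solution _ _ _ _ _ sol.
split=> // Dproj.
have <- // : [set z | Sdir z /\ proj z <> 0] = Sdir.
by apply/seteqP; split=> [z []//|z Dz]; split=> //; exact: Dproj.
Qed.
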